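(* Let $\mathcal{G}$ and $\mathcal{H}$ be DAGs on node set $[p]$. If $\{\mathcal{G},\mathcal{H}\}$ is a turn pair, then $\operatorname{conv}(c_{\mathcal{G}},c_{\mathcal{H}})$ is an edge of $\operatorname{CIM}_G$, where $G$ is the (common) skeleton of $\mathcal{G}$ and $\mathcal{H}$.
   Context: All graphs are simple and $[p]=\{1,\dots,p\}$. A DAG is a directed acyclic graph. The skeleton of a directed graph is the undirected graph obtained by forgetting the directions of the edges. For a DAG $\mathcal{G}$ let $\operatorname{pa}_{\mathcal{G}}(i)=\{k\colon k\to i\in\mathcal{G}\}$; for an undirected graph $G$ let $\operatorname{ne}_G(i)$ be the set of neighbors of $i$ in $G$. Characteristic imset: for a DAG $\mathcal{G}$ on $[p]$, $c_{\mathcal{G}}\colon\{S\subseteq[p]\colon|S|\ge 2\}\to\{0,1\}$ is given by $c_{\mathcal{G}}(S)=1$ if there exists $i\in S$ such that $j\in\operatorname{pa}_{\mathcal{G}}(i)$ for all $j\in S\setminus\{i\}$, and $c_{\mathcal{G}}(S)=0$ otherwise. It is identified with a vector in $\mathbb{R}^{2^p-p-1}$ with standard basis vectors $e_S$ indexed by the sets $S\subseteq[p]$, $|S|\geq 2$. For an undirected graph $G=([p],E)$, $\operatorname{CIM}_G=\operatorname{conv}(c_{\mathcal{G}}\in\mathbb{R}^{2^p-p-1}\colon\mathcal{G}=([p],E)\text{ a DAG with skeleton }G)$. Turn pair: let $\mathcal{G}$ and $\mathcal{H}$ be two DAGs on node set $[p]$ with (the same) skeleton $G$. Suppose there exist $i$,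 $j$, $S_i\subseteq[p]\setminus\{i,j\}$ and $S_j\subseteq[p]\setminus\{i,j\}$ such that (1) $c_{\mathcal{G}}(\{i,j\})=1$ (in particular $i\ne j$); (2) $c_{\mathcal{G}}(S\cup\{i\})=1$ for all $S\subseteq S_i$ with $|S|\ge1$; (3) $c_{\mathcal{G}}(S\cup\{j\})=1$ for all $S\subseteq S_j$ with $|S|\ge1$; (4) either $S_i\not\subseteq\operatorname{ne}_G(j)$ or $S_j\not\subseteq\operatorname{ne}_G(i)$ (inclusive or). Then $\{\mathcal{G},\mathcal{H}\}$ is a turn pair (with respect to $(i,j,S_i,S_j)$) if $$c_{\mathcal{H}}=c_{\mathcal{G}}+\sum_{S\in\mathcal{S}^+}e_S-\sum_{S\in\mathcal{S}^-}e_S,$$ where $\mathcal{S}^+=\{T\cup\{i,j\}\colon T\subseteq S_i,\ T\not\subseteq\operatorname{ne}_G(j)\}$ and $\mathcal{S}^-=\{T\cup\{i,j\}\colon T\subseteq S_j,\ T\not\subseteq\operatorname{ne}_G(i)\}$. An edge of a polytope is a one-dimensional face. *)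

(* Defs.v *)
From HB Require Import structures.
From mathcomp Require Import all_boot all_order all_algebra.
From mathcomp Require Import classical_sets reals.

Set Implicit Arguments.
Unset Strict Implicit.
Unset Printing Implicit Defensive.
Import GRing.Theory Num.Theory.

Local Open Scope ring_scope.

(** * Polytopes in a finite-dimensional real vector space *)

Section Polytope.
Local Open Scope classical_set_scope.
Variables (R : realType) (V : vectType R).

(* With [0 <= a i] this is the convex hull, without it the affine hull. *)
Definition conv (A : set V) : set V :=
  [set x | exists n (a : 'I_n -> R) (v : 'I_n -> V),
     [/\ forall i, 0 <= a i, \sum_(i < n) a i = 1, forall i, A (v i)
       & x = \sum_(i < n) a i *: v i]].

Definition aff (A : set V) : set V :=
  [set x | exists n (a : 'I_n -> R) (v : 'I_n -> V),
     [/\ \sum_(i < n) a i = 1, forall i, A (v i)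
       & x = \sum_(i < n) a i *: v i]].

(* The affine hull of [F] is a translate of a [d]-dimensional subspace; in
   particular [F] is nonempty. *)
Definition has_affine_dim (F : set V) (d : nat) : Prop :=
  exists (x0 : V) (U : {vspace V}),
    \dim U = d /\ aff F = [set x | x - x0 \in U].

(* The zero functional is allowed, so that [P] and [set0] are faces of [P]. *)
Definition is_face (P F : set V) : Prop :=
  exists (w : {linear V -> R^o}) (b : R),
    (forall x, P x -> w x <= b) /\ F = [set x | P x /\ w x = b].

Definition is_edge (P F : set V) : Prop := is_face P F /\ has_affine_dim F 1.

End Polytope.

(** * Directed acyclic graphs and characteristic imsets *)

Section Graph.
Variable p : nat.

(* [cycle D c] is a closed directed walk, so this excludes loops and antiparallel
   arrows as well; closed walks and simple cycles give the same notion. *)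
Definition acyclic (D : rel 'I_p) : Prop := forall c, cycle D c -> c = [::].

Record dag := Dag { arrow :> rel 'I_p; dag_acyclic : acyclic arrow }.

Definition pa (D : dag) (i : 'I_p) : {set 'I_p} := [set k | D k i].

Record ugraph := UGraph {
  adj :> rel 'I_p;
  adj_sym : symmetric adj;
  adj_irrefl : irreflexive adj }.

Definition ne (G : ugraph) (i : 'I_p) : {set 'I_p} := [set k | G k i].

Lemma skeleton_sym (D : dag) : symmetric [rel i j | D i j || D j i].
Proof. by move=> i j /=; rewrite orbC. Qed.

Lemma skeleton_irrefl (D : dag) : irreflexive [rel i j | D i j || D j i].
Proof.
move=> i /=; rewrite orbb; apply/negP => Dii.
by have := @dag_acyclic D [:: i]; rewrite /= Dii => /(_ isT).
Qed.

Definition skeleton (D : dag) : ugraph :=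
  UGraph (skeleton_sym D) (skeleton_irrefl D).

Definition has_skeleton (D : dag) (G : ugraph) : Prop := skeleton D =2 G.

(* The guard makes [imset_at D S] false outside the domain [#|S| >= 2] of the
   characteristic imset. *)
Definition imset_at (D : dag) (S : {set 'I_p}) : bool :=
  (1 < #|S|)%N && [exists i in S, [forall j in S :\ i, j \in pa D i]].

Definition coord := {S : {set 'I_p} | (1 < #|S|)%N}.

End Graph.

Section CIM.
Variables (R : realType) (p : nat).

Definition imset_space : vectType R := {ffun coord p -> R^o}.

Definition char_imset (D : dag p) : imset_space :=
  [ffun S : coord p => (imset_at D (val S))%:R : R^o].

Definition basis_vec (S : coord p) : imset_space :=
  [ffun T : coord p => (T == S)%:R : R^o].

Definition CIM (G : ugraph p) : set imset_space :=
  conv [set x | exists2 D : dag p, has_skeleton D G & x = char_imset D]%classic.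

(* The family [{T ∪ {i,j} : T ⊆ A, T ⊄ ne_G(k)}]: it is S^+ for [A = S_i],
   [k = j], and S^- for [A = S_j], [k = i]. *)
Definition turn_family (G : ugraph p) (i j : 'I_p) (A : {set 'I_p}) (k : 'I_p) :
    {set {set 'I_p}} :=
  [set T :|: [set i; j] | T in powerset A & ~~ (T \subset ne G k)].

Definition turn_pair_wrt (D H : dag p) (i j : 'I_p) (Si Sj : {set 'I_p}) : Prop :=
  let G := skeleton D in
  [/\ has_skeleton H G,
      Si \subset ~: [set i; j] /\ Sj \subset ~: [set i; j],
      imset_at D [set i; j],
      (forall S : {set 'I_p}, S \subset Si -> (0 < #|S|)%N -> imset_at D (i |: S)) /\
      (forall S : {set 'I_p}, S \subset Sj -> (0 < #|S|)%N -> imset_at D (j |: S))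
    & ~~ (Si \subset ne G j) || ~~ (Sj \subset ne G i)]
  /\ char_imset H = char_imset D
       + \sum_(S : coord p | val S \in turn_family G i j Si j) basis_vec S
       - \sum_(S : coord p | val S \in turn_family G i j Sj i) basis_vec S.

(* A turn pair is an unordered pair: either of the two DAGs may play the role
   of the first one. *)
Definition turn_pair (D H : dag p) : Prop :=
  exists (i j : 'I_p) (Si Sj : {set 'I_p}),
    turn_pair_wrt D H i j Si Sj \/ turn_pair_wrt H D i j Si Sj.

End CIM.

Arguments char_imset R {p} D.
Arguments CIM R {p} G _.
Arguments turn_pair R {p} D H.

(* Main.v *)
(* The imsets of D and H agree off the disjoint families S^+ and S^-, so they lie
   on a common face of the cube. For a DAG E on that face with the right skeleton,
   the vertex dominating T ∪ {i,j} in S^+ can only be i, hence c_E(T ∪ {i,j}) = 1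
   iff j -> i and T ⊆ pa_E(i); symmetrically on S^- with i -> j. So at most one of
   the families carries ones, and the value 1 on the largest set of a family
   forces 1 on the whole family and hence c_E = c_H or c_E = c_D. If both families
   are nonempty, the sum of the two top coordinates is therefore maximal exactly
   at D and H on this face. *)
Require Import Defs.
From mathcomp Require Import all_boot all_order all_algebra.
From mathcomp Require Import classical_sets reals.
From mathcomp Require Import ring lra fintype finset.
From HB Require Import structures.

Set Implicit Arguments.
Unset Strict Implicit.
Unset Printing Implicit Defensive.
Import Order.TTheory GRing.Theory Num.Theory.

Local Open Scope ring_scope.

(** * Segments as edges of convex hulls *)

Section EdgeCriterion.
Local Open Scope classical_set_scope.
Variables (R : realType) (V : vectType R).
Implicit Types (P : set V) (u v x : V) (w f g : {linear V -> R^o}).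

Lemma conv_set2P u v x :
  conv [set u; v] x -> exists2 t : R, 0 <= t <= 1 & x = u + t *: (v - u).
Proof.
move=> [n [a [y [a0 a1 yuv ->]]]].
(* The parameter [t] is the total weight of the points other than [u], which all equal [v]. *)
exists (\sum_(k < n | y k != u) a k).
  rewrite sumr_ge0//= -a1 [leRHS](bigID (fun k => y k != u)) /= lerDl.
  by rewrite sumr_ge0.
have -> : u = \sum_(k < n) a k *: u by rewrite -scaler_suml a1 scale1r.
rewrite [X in _ + X *: _]big_mkcond scaler_suml -big_split/=.
apply: eq_bigr => k _.
rewrite -scaler_suml a1 scale1r.
case: (eqVneq (y k) u) => [->|]; first by rewrite scale0r addr0.
by case: (yuv k) => [->|-> _]; rewrite ?eqxx// -scalerDr addrC subrK.
Qed.

Lemma has_affine_dim_conv_set2 u v :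
  u != v -> has_affine_dim (conv [set u; v]) 1.
Proof.
move=> uv; exists u, <[v - u]>%VS; split.
  by rewrite dim_vline subr_eq0 eq_sym uv.
have inconv y : [set u; v] y -> conv [set u; v] y.
  move=> uvy; exists 1%N, (fun=> 1), (fun=> y).
  by split=> //; rewrite big_ord1 ?scale1r.
apply/seteqP; split=> x /=.
  move=> [n [a [y [a1 yuv ->]]]].
  rewrite -[X in _ - X]scale1r -a1 scaler_suml -sumrB.
  apply: memv_suml => k _; rewrite -scalerBr memvZ//.
  have [t _ ->] := conv_set2P (yuv k).
  by rewrite addrAC subrr add0r memvZ// memv_line.
move=> /vlineP[t xu].
exists 2%N, (fun k => if k == ord0 then 1 - t else t),
  (fun k => if k == ord0 then u else v); split.
- by rewrite !big_ord_recl big_ord0 /= addr0 subrK.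
- by move=> k; apply: inconv; case: eqP => _; [left|right].
- rewrite !big_ord_recl big_ord0 /= addr0 -[LHS](subrK u) xu.
  by rewrite scalerBr scalerBl scale1r [LHS]addrC addrA addrAC.
Qed.

(** A convex combination reaches the maximum [b] of [w] only if every generator of nonzero weight
    does, and only [u] and [v] can. *)
Lemma is_edge_conv P u v w b : P u -> P v -> u != v -> w u = b -> w v = b ->
  (forall x, P x -> [\/ x = u, x = v | w x < b]) ->
  is_edge (conv P) (conv [set u; v]).
Proof.
move=> Pu Pv uv wu wv Pw; split; last exact: has_affine_dim_conv_set2.
have Pwle x : P x -> w x <= b.
  by move=> /Pw[->|->|/ltW//]; rewrite ?wu ?wv.
exists w, b; split.
  move=> _ [n [a [y [a0 a1 yP ->]]]]; rewrite linear_sum/=.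
  rewrite -[b]mul1r -a1 mulr_suml; apply: ler_sum => k _.
  by rewrite linearZ/= ler_wpM2l// Pwle.
apply/seteqP; split=> x.
  move=> uvx; split; last first.
    have [t _ ->] := conv_set2P uvx.
    by rewrite linearD linearZ linearB/= wu wv subrr scaler0 addr0.
  have [n [a [y [a0 a1 yuv ->]]]] := uvx.
  by exists n, a, y; split=> // k; case: (yuv k) => ->.
move=> [[n [a [y [a0 a1 yP ->]]]] wb].
(* The weighted deficits are nonnegative and sum to zero, so each vanishes. *)
have gap : \sum_(k < n) a k * (b - w (y k)) = 0.
  under eq_bigr do rewrite mulrBr.
  rewrite sumrB -mulr_suml a1 mul1r; apply/eqP; rewrite subr_eq0; apply/eqP.
  by rewrite -wb linear_sum/=; apply: eq_bigr => k _; rewrite linearZ.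
have gap0 k : a k * (b - w (y k)) = 0.
  move/eqP: gap; rewrite psumr_eq0 => [/allP/(_ k)|{}k _].
    by rewrite mem_index_enum => /(_ isT)/eqP.
  by rewrite mulr_ge0// subr_ge0 Pwle.
(* Points of weight zero are unconstrained; [u] is put in their place. *)
exists n, a, (fun k => if a k == 0 then u else y k); split=> // [k|].
  case: eqP => [_|/eqP ak0]; first by left.
  move/eqP: (gap0 k); rewrite mulf_eq0 (negbTE ak0)/= subr_eq0 => /eqP bE.
  by case: (Pw _ (yP k)) => [->|->|]; [left|right|rewrite -bE ltxx].
by apply: eq_bigr => k _; case: eqP => // ->; rewrite !scale0r.
Qed.

(* Being an edge of a face: [f] cuts out the face, and a large multiple of [f]
   added to [g] cuts out the edge. *)
Lemma is_edge_conv_lex P u v f g b c M :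
  P u -> P v -> u != v -> f u = b -> f v = b -> g u = c -> g v = c ->
  (forall x, P x -> g x <= M) ->
  (forall x, P x -> f x <= b - 1 \/
     f x = b /\ [\/ x = u, x = v | g x < c]) ->
  is_edge (conv P) (conv [set u; v]).
Proof.
move=> Pu Pv uv fu fv gu gv gM fg.
(* With [K > M - c], losing at least 1 in [f] outweighs any gain in [g], since
   [K * (b - 1) + M < K * b + c]. *)
pose K := M - c + 1.
have Kgt0 : 0 < K by have := gM u Pu; rewrite gu /K; lra.
pose w : {linear V -> R^o} := (K \*: f \+ g).
have wE x : w x = K * f x + g x by [].
apply: (@is_edge_conv P u v w (K * b + c)) => //; rewrite ?wE ?fu ?gu ?fv ?gv//.
move=> x Px; rewrite wE; case: (fg x Px) => [fx|[-> [xu|xv|gx]]].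
- apply: Or33; have gx := gM x Px.
  have : K * f x <= K * (b - 1) by rewrite ler_pM2l.
  rewrite mulrBr mulr1 => Kfx.
  by apply: le_lt_trans (lerD Kfx gx) _; rewrite -addrA ltrD2l /K; lra.
- exact: Or31.
- exact: Or32.
- by apply: Or33; rewrite ltrD2l.
Qed.

End EdgeCriterion.

(** * Linear functionals on the imset space *)

Section Functional.
Variables (R : realType) (p : nat) (a : Defs.coord p -> R).

Definition coord_form (x : imset_space R p) : R^o :=
  \sum_S a S * (x : {ffun Defs.coord p -> R^o}) S.

Lemma coord_form_is_linear : linear coord_form.
Proof.
move=> k x y; rewrite /coord_form scaler_sumr -big_split/=.
by apply: eq_bigr => S _; rewrite !ffunE mulrDr mulrCA.
Qed.

HB.instance Definition _ :=
  GRing.isLinear.Build R (imset_space R p) R^o *:%R coord_form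
    coord_form_is_linear.

Lemma coord_form_imset D :
  coord_form (char_imset R D) = \sum_S a S * (imset_at D (val S))%:R.
Proof. by apply: eq_bigr => S _; rewrite ffunE. Qed.

(** Imset entries are 0 or 1; this supplies the bound [M] of [is_edge_conv_lex]. *)
Lemma coord_form_imset_le D :
  coord_form (char_imset R D) <= \sum_S `|a S|.
Proof.
rewrite coord_form_imset; apply: ler_sum => S _.
by case: imset_at; rewrite ?mulr1 ?mulr0// ler_norm.
Qed.

End Functional.

(** * Characteristic imsets and turn families *)

Section Imset.
Variable p : nat.
Implicit Types (D H : dag p) (G : ugraph p) (i j : 'I_p) (S T A B : {set 'I_p}).

Lemma dag_asym D i j : D i j -> ~~ D j i.
Proof.
move=> ij; apply/negP => ji.
by have := @dag_acyclic _ D [:: i; j]; rewrite /= ij ji => /(_ isT).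
Qed.

Lemma dag_acyclic3 D i j k : D i j -> D j k -> ~~ D k i.
Proof.
move=> ij jk; apply/negP => ki.
by have := @dag_acyclic _ D [:: i; j; k]; rewrite /= ij jk ki => /(_ isT).
Qed.

Lemma imset_atP D S : reflect
  ((1 < #|S|)%N /\ exists2 k, k \in S & forall l, l \in S -> l != k -> D l k)
  (imset_at D S).
Proof.
apply: (iffP andP) => -[S1].
  move=> /exists_inP[k kS /forall_inP Sk]; split=> //; exists k => // l lS lk.
  by have := Sk l; rewrite !inE lk lS => /(_ isT).
move=> [k kS Sk]; split=> //; apply/exists_inP; exists k => //.
by apply/forall_inP => l; rewrite !inE => /andP[lk lS]; exact: Sk.
Qed.

Lemma imset_at_pair G D i j : has_skeleton D G -> i != j ->
  imset_at D [set i; j] = G i j.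
Proof.
move=> DG ij; rewrite -DG /=; apply/imset_atP/orP => [[_ [k]]|Dij].
  rewrite !inE => /orP[] /eqP -> kD; [right|left]; apply: kD;
    by rewrite ?inE ?eqxx ?orbT// eq_sym.
split; first by rewrite cards2 ij.
case: Dij => Dij; [exists j|exists i]; rewrite ?inE ?eqxx ?orbT// => l.
  by rewrite !inE => /orP[]/eqP->//; rewrite eqxx.
by rewrite !inE => /orP[]/eqP->//; rewrite eqxx.
Qed.

(** On sets with fewer than two elements [imset_at] is false for every DAG, so the coordinates of
    the vector determine it everywhere. *)
Lemma char_imset_inj (R : realType) D H :
  char_imset R D = char_imset R H <-> imset_at D =1 imset_at H.
Proof.
split=> [DH S|DH]; last by apply/ffunP => S; rewrite !ffunE DH.
case: (boolP (1 < #|S|)%N) => [S1|/negbTE S1]; last by rewrite /imset_at S1.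
have := congr1 (fun x : {ffun Defs.coord p -> R^o} => x (Sub S S1)) DH.
by rewrite !ffunE SubK => /eqP; rewrite eqr_nat; do 2!case: imset_at.
Qed.

Lemma turn_familyP G i j A k S : reflect
  (exists T, [/\ T \subset A, ~~ (T \subset ne G k) & S = T :|: [set i; j]])
  (S \in turn_family G i j A k).
Proof.
apply: (iffP imsetP) => [[T]|[T [TA Tk ->]]].
  by rewrite inE powersetE => /andP[TA Tk] ->; exists T.
by exists T => //; rewrite inE powersetE TA.
Qed.

Lemma turn_familyC G i j A k : turn_family G i j A k = turn_family G j i A k.
Proof. by apply/setP => S; apply/turn_familyP/turn_familyP; rewrite setUC. Qed.

Lemma card_turn_set i j T : i != j -> (1 < #|T :|: [set i; j]|)%N.
Proof.
move=> ij; apply: leq_trans (subset_leq_card (subsetUr _ _)).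
by rewrite cards2 ij.
Qed.

Lemma imset_at_turn D i j T : i != j -> D j i -> T \subset pa D i ->
  imset_at D (T :|: [set i; j]).
Proof.
move=> ij ji Ti; apply/imset_atP; split; first exact: card_turn_set.
exists i; first by rewrite !inE eqxx orbT.
move=> l; rewrite !inE => /or3P[lT _|/eqP->|/eqP->//]; last by rewrite eqxx.
by have := subsetP Ti l lT; rewrite inE.
Qed.

(* If the dominating vertex were some [k \in T], then with [s \in T] not adjacent
   to [j] the collider s -> k <- j would also be in [D0], as {s, j, k} avoids [i];
   there it forces [i] to be a common child of [s] and [j], or [k] a common child
   of [s], [i] and [j], contradicting the zeros of [D0]. *)
Lemma turn_imset_at G D0 D i j A T :
  has_skeleton D0 G -> has_skeleton D G -> G i j ->
  A \subset ne G i -> j \notin A ->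
  {in turn_family G i j A j, forall S, ~~ imset_at D0 S} ->
  (forall S, i \notin S -> imset_at D S = imset_at D0 S) ->
  T \subset A -> ~~ (T \subset ne G j) ->
  imset_at D (T :|: [set i; j]) -> D j i /\ T \subset pa D i.
Proof.
move=> D0G DG Gij Ai jA D0fam DD0 TA Tj.
have ij : i != j by apply/eqP => ij; rewrite ij adj_irrefl in Gij.
have iA : i \notin A.
  by apply/negP => /(subsetP Ai); rewrite inE adj_irrefl.
have /subsetPn[s sT] := Tj; rewrite inE => sj.
have sA := subsetP TA s sT.
have noedge E : has_skeleton E G -> ~~ E s j /\ ~~ E j s.
  by move=> EG; apply/andP; rewrite -negb_or; move: sj; rewrite -EG.
have sNj : s != j by apply: contraNneq jA => <-.
have sNi : s != i by apply: contraNneq iA => <-.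
move=> /imset_atP[_ [k kT Tk]].
have Tk' l : l \in T -> l != k -> D l k.
  by move=> lT; apply: Tk; rewrite inE lT.
have jk : j != k -> D j k by apply: Tk; rewrite !inE eqxx !orbT.
have [Dsj Djs] := noedge D DG; have [D0sj D0js] := noedge D0 D0G.
move: kT; rewrite !inE => /or3P[kT|/eqP ki|/eqP kj]; first last.
- by move: (Tk' s sT); rewrite kj (negbTE Dsj) => /(_ sNj).
- split; first by rewrite -ki jk// ki eq_sym.
  apply/subsetP => l lT; rewrite inE -ki Tk'// ki.
  by apply: contraNneq iA => <-; apply: (subsetP TA).
have kA := subsetP TA k kT.
have kNj : j != k by apply: contraNneq jA => ->.
have kNi : i != k by apply: contraNneq iA => ->.
have sNk : s != k.
  by apply: contraNneq Djs => ->; apply: jk.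
have : imset_at D [set s; j; k].
  apply/imset_atP; split.
    apply: leq_trans (subset_leq_card (subsetUl _ _)).
    by rewrite cards2 sNj.
  exists k; first by rewrite !inE eqxx orbT.
  move=> l; rewrite !inE -orbA => /or3P[]/eqP-> //.
  - exact: Tk'.
  - by rewrite eqxx.
rewrite DD0; last by rewrite !inE !negb_or eq_sym sNi ij kNi.
move=> /imset_atP[_ [v]].
have sin : s \in [set s; j; k] by rewrite !inE eqxx.
have jin : j \in [set s; j; k] by rewrite !inE eqxx orbT.
(* A dominating [s] or [j] would make [s] and [j] adjacent, so [k] dominates in [D0] too. *)
rewrite !inE -orbA => /or3P[]/eqP-> vD.
- by have := vD j jin; rewrite (negbTE D0js) eq_sym => /(_ sNj).
- by have := vD s sin; rewrite (negbTE D0sj) => /(_ sNj).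
have sk := vD s sin sNk; have {}jk0 := vD j jin kNj.
have fam B : B \subset A -> s \in B -> ~~ imset_at D0 (B :|: [set i; j]).
  move=> BA sB; apply: D0fam; apply/turn_familyP; exists B; split=> //.
  by apply/subsetPn; exists s => //; rewrite inE.
have Gi l : l \in A -> G l i by move=> /(subsetP Ai); rewrite inE.
have tot l : l \in A -> D0 l i || D0 i l by move=> /Gi; rewrite -D0G.
(* If [i -> k], then [k] would be a common child of [s], [i], [j], a one of [D0] inside the
   family. *)
have D0ki : D0 k i.
  have := tot k kA; case/orP => // D0ik.
  have : ~~ imset_at D0 ([set s; k] :|: [set i; j]).
    apply: fam; last by rewrite !inE eqxx.
    by apply/subsetP => l; rewrite !inE => /orP[]/eqP->.
  case/imset_atP; split.
    apply: leq_trans (subset_leq_card (subsetUl _ _)).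
    by rewrite cards2 sNk.
  exists k; first by rewrite !inE eqxx orbT.
  by move=> l; rewrite !inE -!orbA => /or4P[]/eqP->//; rewrite eqxx.
(* Acyclicity along [s -> k -> i] and [j -> k -> i] makes [i] a common child of [s] and [j], again a
   one inside the family. *)
have D0si : D0 s i.
  by have := tot s sA; rewrite (negbTE (dag_acyclic3 sk D0ki)) orbF.
have D0ji : D0 j i.
  have : G j i by rewrite adj_sym.
  by rewrite -D0G /= (negbTE (dag_acyclic3 jk0 D0ki)) orbF.
have : ~~ imset_at D0 ([set s] :|: [set i; j]).
  by apply: fam; rewrite ?sub1set// !inE.
rewrite imset_at_turn//.
by rewrite sub1set inE.
Qed.

(** * Turn configurations and the DAGs on their common face *)

(** The turn equation read coordinatewise, in a form invariant under exchanging [D] with [H], [i]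
    with [j] and [A] with [B] simultaneously. *)
Record turn_config G D H i j A B : Prop := TurnConfig {
  turn_skelD : has_skeleton D G;
  turn_skelH : has_skeleton H G;
  turn_adj : G i j;
  turn_subi : A \subset ne G i;
  turn_subj : B \subset ne G j;
  turn_notinA : j \notin A;
  turn_notinB : i \notin B;
  turn_plus : {in turn_family G i j A j, forall S,
    ~~ imset_at D S /\ imset_at H S};
  turn_minus : {in turn_family G i j B i, forall S,
    imset_at D S /\ ~~ imset_at H S};
  turn_eq : forall S, S \notin turn_family G i j A j ->
    S \notin turn_family G i j B i -> imset_at D S = imset_at H S }.

Lemma turn_config_sym G D H i j A B :
  turn_config G D H i j A B -> turn_config G H D j i B A.
Proof.
case=> DG HG Gij Ai Bj jA iB fp fm feq; split=> //.
- by rewrite adj_sym.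
- by move=> S; rewrite turn_familyC => /fm[].
- by move=> S; rewrite turn_familyC => /fp[].
- by move=> S; rewrite !(turn_familyC _ j i) => SB SA; rewrite feq.
Qed.

(** All sets of both families contain [i], so [E] agrees with [D] on every set avoiding [i], and
    [turn_imset_at] applies with [D] as [D0]. *)
Lemma turn_face_plus G D H E i j A B T :
  turn_config G D H i j A B -> has_skeleton E G ->
  (forall S, imset_at D S = imset_at H S -> imset_at E S = imset_at D S) ->
  T \subset A -> ~~ (T \subset ne G j) ->
  imset_at E (T :|: [set i; j]) -> E j i /\ T \subset pa E i.
Proof.
case=> DG HG Gij Ai Bj jA iB fp fm feq EG EDH.
apply: (turn_imset_at DG) => // [S /fp[]//|S iS].
by apply: EDH; apply: feq; apply: contra iS => /turn_familyP[U [_ _ ->]];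
  rewrite !inE eqxx orbT.
Qed.

(** The top one gives [j -> i] and makes all of [A] parents of [i], hence ones on all of S^+; a one
    in S^- would give [i -> j] by symmetry. *)
Lemma turn_face_top G D H E i j A B :
  turn_config G D H i j A B -> has_skeleton E G ->
  (forall S, imset_at D S = imset_at H S -> imset_at E S = imset_at D S) ->
  ~~ (A \subset ne G j) -> imset_at E (A :|: [set i; j]) ->
  imset_at E =1 imset_at H.
Proof.
move=> tc EG EDH Aj EA.
have [Eji AE] := turn_face_plus tc EG EDH (subxx A) Aj EA.
have [DG HG Gij Ai Bj jA iB fp fm feq] := tc.
have ij : i != j by apply/eqP => ij; rewrite ij adj_irrefl in Gij.
move=> S; case: (boolP (S \in turn_family G i j A j)) => Sp.
  rewrite (fp S Sp).2; have /turn_familyP[T [TA _ ->]] := Sp.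
  by rewrite imset_at_turn// (subset_trans TA).
case: (boolP (S \in turn_family G i j B i)) => Sm; last first.
  by rewrite EDH ?feq.
rewrite (negbTE (fm S Sm).2); apply/negbTE/negP => ES.
have /turn_familyP[T [TB Ti SE]] := Sm.
have EHD U : imset_at H U = imset_at D U -> imset_at E U = imset_at H U.
  by move=> HD; rewrite EDH.
have [] := turn_face_plus (turn_config_sym tc) EG EHD TB Ti.
  by rewrite [X in _ :|: X]setUC -SE.
by rewrite (negbTE (dag_asym Eji)).
Qed.

(** Since entries are 0 or 1 and the families are disjoint, the vector equation determines both
    entries on each family. *)
Lemma turn_pair_config (R : realType) G D H i j A B :
  has_skeleton D G -> turn_pair_wrt R D H i j A B -> turn_config G D H i j A B.
Proof.
move=> DG [[HD [Aij Bij] Dij [DA DB] _] DHE].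
have neE k : ne (skeleton D) k = ne G k.
  by apply/setP => l; rewrite !inE DG.
have famE C k : turn_family (skeleton D) i j C k = turn_family G i j C k.
  by rewrite /turn_family neE.
have ij : i != j by case/imset_atP: Dij; rewrite cards2; case: eqP.
have jA : j \notin A.
  by apply/negP => /(subsetP Aij); rewrite !inE eqxx orbT.
have iA : i \notin A by apply/negP => /(subsetP Aij); rewrite !inE eqxx.
have jB : j \notin B.
  by apply/negP => /(subsetP Bij); rewrite !inE eqxx orbT.
have iB : i \notin B by apply/negP => /(subsetP Bij); rewrite !inE eqxx.
(* Conditions (2) and (3) on singletons are adjacencies. *)
have sub k (C : {set 'I_p}) : k \notin C ->
    (forall S, S \subset C -> (0 < #|S|)%N -> imset_at D (k |: S)) ->
    C \subset ne G k.
  move=> kC DC; apply/subsetP => l lC; rewrite inE adj_sym -(imset_at_pair DG).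
    by apply: DC; rewrite ?sub1set ?cards1.
  by apply: contraNneq kC => ->.
have Ai := sub i A iA DA; have Bj := sub j B jB DB.
(* If [T] and [U] give the same set, then [T] lies in [B] and so in [ne G j], against the choice of
   [T]. *)
have disj S : S \in turn_family G i j A j -> S \notin turn_family G i j B i.
  move=> /turn_familyP[T [TA Tj SE]]; apply/negP => /turn_familyP[U [UB Ui]].
  rewrite SE => TU; case/negP: Tj; apply: subset_trans Bj.
  apply/subsetP => l lT; apply: (subsetP UB).
  have := subsetP Aij l (subsetP TA l lT); rewrite !inE => lij.
  by have /setP/(_ l) := TU; rewrite !inE lT (negbTE lij) !orbF => <-.
have card_fam C k S : S \in turn_family G i j C k -> (1 < #|S|)%N.
  by move=> /turn_familyP[T [_ _ ->]]; exact: card_turn_set.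
have sumE (F : {set {set 'I_p}}) (S : Defs.coord p) :
    (\sum_(T : Defs.coord p | val T \in F) basis_vec R T
      : {ffun Defs.coord p -> R^o}) S = (val S \in F)%:R.
  rewrite sum_ffunE; under eq_bigr do rewrite ffunE.
  case: (boolP (val S \in F)) => SF; last first.
    by rewrite big1// => T TF; case: eqP => // ST; rewrite ST TF in SF.
  rewrite (bigD1 S)//= eqxx big1 ?addr0// => T /andP[_ TS].
  by rewrite eq_sym (negbTE TS).
(* Moving the subtracted term to the left makes this an equation of natural numbers. *)
have key S : (1 < #|S|)%N ->
    (imset_at H S + (S \in turn_family G i j B i)
     = imset_at D S + (S \in turn_family G i j A j))%N.
  move=> S1.
  have := congr1 (fun x : {ffun Defs.coord p -> R^o} => x (Sub S S1)) DHE.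
  rewrite !ffunE !sumE !famE SubK => /eqP.
  by rewrite -subr_eq opprK -!natrD eqr_nat => /eqP.
split=> //.
- by move=> k l; rewrite HD DG.
- by rewrite -(imset_at_pair DG).
- move=> S SA; have := key S (card_fam _ _ _ SA).
  by rewrite SA (negbTE (disj S SA)); case: imset_at; case: imset_at.
- move=> S SB; have := key S (card_fam _ _ _ SB); rewrite SB.
  have /negbTE-> : S \notin turn_family G i j A j.
    by apply/negP => /disj; rewrite SB.
  by case: imset_at; case: imset_at.
- move=> S /negbTE SA /negbTE SB.
  case: (boolP (1 < #|S|)%N) => [/key|/negbTE S1]; last by rewrite /imset_at S1.
  by rewrite SA SB !addn0; case: imset_at; case: imset_at.
Qed.

End Imset.

(** * Edges of the imset polytope *)

Section Edge.
Variables (R : realType) (p : nat) (G : ugraph p).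
Implicit Types (D H E : dag p) (i j : 'I_p) (S A B : {set 'I_p}).

(** The cube face through both imsets is cut out first, so [a] need only separate [D] and [H] from
    the other DAGs on it. *)
Lemma is_edge_CIM D H (a : Defs.coord p -> R) c :
  has_skeleton D G -> has_skeleton H G -> ~ imset_at D =1 imset_at H ->
  coord_form a (char_imset R D) = c -> coord_form a (char_imset R H) = c ->
  (forall E, has_skeleton E G ->
    (forall S, imset_at D S = imset_at H S -> imset_at E S = imset_at D S) ->
    [\/ imset_at E =1 imset_at D, imset_at E =1 imset_at H
      | coord_form a (char_imset R E) < c]) ->
  is_edge (CIM R G) (conv [set char_imset R D; char_imset R H]%classic).
Proof.
move=> DG HG DH aD aH aE.
(* Weight +1 on common ones, -1 on common zeros, 0 where [D] and [H] differ. *)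
pose s (S : Defs.coord p) : R :=
  if imset_at D (val S) == imset_at H (val S)
  then (-1) ^+ ~~ imset_at D (val S) else 0.
pose diff E (S : Defs.coord p) := (imset_at D (val S) == imset_at H (val S))
  && (imset_at E (val S) != imset_at D (val S)).
(* Each deviation from a common value costs exactly 1, the gap that [is_edge_conv_lex] asks for. *)
have sE E : coord_form s (char_imset R E)
    = coord_form s (char_imset R D) - \sum_S (diff E S)%:R.
  rewrite !coord_form_imset -sumrB; apply: eq_bigr => S _; rewrite /s /diff.
  by case: imset_at; case: imset_at; case: imset_at => /=; ring.
apply: (@is_edge_conv_lex _ _ _ _ _ (coord_form s) (coord_form a)
  (coord_form s (char_imset R D)) c (\sum_S `|a S|)) => //.
- by exists D.
- by exists H.
- by apply/eqP => /(@char_imset_inj p R).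
- rewrite /= (sE H) big1 ?subr0// => S _.
  by rewrite /diff; case: eqP => //= ->; rewrite eqxx.
- by move=> _ [E _ ->]; exact: coord_form_imset_le.
move=> _ [E EG ->]; rewrite /= (sE E).
case: (boolP [exists S, diff E S]) => [/existsP[S ES]|].
  left; rewrite lerD2l lerN2 (bigD1 S)//= ES lerDl.
  by apply: sumr_ge0 => T _; rewrite ler0n.
rewrite negb_exists => /forallP Ediff; right; split.
  by rewrite big1 ?subr0// => S _; rewrite (negbTE (Ediff S)).
case: (aE E EG) => [S DHS|/char_imset_inj ->|/char_imset_inj ->|].
- case: (boolP (1 < #|S|)%N) => [S1|/negbTE S1]; last by rewrite /imset_at S1.
  by have := Ediff (Sub S S1); rewrite /diff SubK DHS eqxx negbK => /eqP.
- exact: Or31.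
- exact: Or32.
- exact: Or33.
Qed.

Lemma sum_coord_eq S (x : {set 'I_p} -> R) : (1 < #|S|)%N ->
  \sum_(T : Defs.coord p) (val T == S)%:R * x (val T) = x S.
Proof.
move=> S1; rewrite (bigD1 (Sub S S1))//= eqxx mul1r big1 ?addr0// => T TS.
rewrite -[X in _ == X]/(val (Sub S S1 : Defs.coord p)) val_eqE.
by rewrite (negbTE TS) mul0r.
Qed.

Lemma turn_config_edge D H i j A B :
  turn_config G D H i j A B -> ~~ (A \subset ne G j) ->
  is_edge (CIM R G) (conv [set char_imset R D; char_imset R H]%classic).
Proof.
move=> tc Aj; have [DG HG Gij Ai Bj jA iB fp fm feq] := tc.
have ij : i != j by apply/eqP => ij; rewrite ij adj_irrefl in Gij.
have card_top C := card_turn_set C ij.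
have Ap : A :|: [set i; j] \in turn_family G i j A j.
  by apply/turn_familyP; exists A.
have [/negbTE DA HA] := fp _ Ap.
have DH : ~ imset_at D =1 imset_at H.
  by move=> /(_ (A :|: [set i; j])); rewrite DA HA.
case: (boolP (B \subset ne G i)) => Bi.
  have fm0 : turn_family G i j B i = set0.
    apply/setP => S; rewrite inE; apply/negbTE/negP.
    move=> /turn_familyP[T [TB /negP Ti _]]; apply: Ti.
    exact: subset_trans Bi.
  (* The top coordinate forces all of S^+, so [N * x_top - \sum_(S^+) x] is
     maximal exactly when the S^+ coordinates are all equal. *)
  pose N : R := \sum_(S : Defs.coord p | val S \in turn_family G i j A j) 1.
  pose a (S : Defs.coord p) : R := (val S == A :|: [set i; j])%:R * N
    - (val S \in turn_family G i j A j)%:R.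
  have aE E : coord_form a (char_imset R E)
      = N * (imset_at E (A :|: [set i; j]))%:R
        - \sum_(S : Defs.coord p | val S \in turn_family G i j A j)
            (imset_at E (val S))%:R.
    rewrite coord_form_imset; under eq_bigr do rewrite mulrBl -mulrA.
    rewrite sumrB (sum_coord_eq (fun S => N * (imset_at E S)%:R))//.
    congr (_ - _); rewrite [RHS]big_mkcond; apply: eq_bigr => S _.
    by case: ifP; rewrite ?mul1r ?mul0r.
  apply: (is_edge_CIM (a := a) (c := 0)) => //.
  - rewrite aE DA mulr0 sub0r big1 ?oppr0// => S /fp[/negbTE-> _].
    by [].
  - rewrite aE HA mulr1; apply/eqP; rewrite subr_eq0; apply/eqP.
    by apply: eq_bigr => S /fp[_ ->].
  move=> E EG EDH; case: (boolP (imset_at E (A :|: [set i; j]))) => EA.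
    by apply: Or32; exact: turn_face_top tc EG EDH Aj EA.
  (* With a zero at the top, [a] counts the ones on S^+ negatively; without any, [E] has the imset
     of [D]. *)
  case: (boolP [exists S : Defs.coord p,
      (val S \in turn_family G i j A j) && imset_at E (val S)]).
    move=> /existsP[S /andP[SA ES]]; apply: Or33.
    rewrite aE (negbTE EA) mulr0 sub0r oppr_lt0 (bigD1 S)//= ES.
    by apply: ltr_wpDr => //; apply: sumr_ge0 => T _; rewrite ler0n.
  rewrite negb_exists => /forallP Efam; apply: Or31 => S.
  case: (boolP (S \in turn_family G i j A j)) => SA; last first.
    by rewrite EDH// feq// fm0 inE.
  rewrite (negbTE (fp S SA).1).
  case: (boolP (1 < #|S|)%N) => [S1|/negbTE S1]; last by rewrite /imset_at S1.
  by have := Efam (Sub S S1); rewrite SubK SA => /negbTE.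
have Bm : B :|: [set i; j] \in turn_family G i j B i.
  by apply/turn_familyP; exists B.
have [DB /negbTE HB] := fm _ Bm.
(* A one at the top of S^+ forces the imset of [H], a one at the top of S^- that of [D]; any other
   DAG on the face gets 0. *)
pose a (S : Defs.coord p) : R := (val S == A :|: [set i; j])%:R
  + (val S == B :|: [set i; j])%:R.
have aE E : coord_form a (char_imset R E) =
    (imset_at E (A :|: [set i; j]))%:R + (imset_at E (B :|: [set i; j]))%:R.
  rewrite coord_form_imset; under eq_bigr do rewrite mulrDl.
  by rewrite big_split/= !(sum_coord_eq (fun S => (imset_at E S)%:R)).
apply: (is_edge_CIM (a := a) (c := 1)) => //.
- by rewrite aE DA DB add0r.
- by rewrite aE HA HB addr0.
move=> E EG EDH; case: (boolP (imset_at E (A :|: [set i; j]))) => EA.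
  by apply: Or32; exact: turn_face_top tc EG EDH Aj EA.
case: (boolP (imset_at E (B :|: [set i; j]))) => EB.
  apply: Or31; apply: turn_face_top (turn_config_sym tc) EG _ Bi _.
    by move=> S HD; rewrite EDH.
  by rewrite [X in _ :|: X]setUC.
by apply: Or33; rewrite aE (negbTE EA) (negbTE EB) addr0.
Qed.

(** Condition (4) makes one family nonempty; if it is S^-, the symmetric configuration turns it into
    S^+. *)
Lemma turn_pair_wrt_edge D H i j A B :
  has_skeleton D G -> turn_pair_wrt R D H i j A B ->
  is_edge (CIM R G) (conv [set char_imset R D; char_imset R H]%classic).
Proof.
move=> DG tp; have tc := turn_pair_config DG tp.
have neE k : ne (skeleton D) k = ne G k.
  by apply/setP => l; rewrite !inE DG.
case: tp => -[_ _ _ _]; rewrite !neE => /orP[Aj|Bi] _.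
  exact: turn_config_edge tc Aj.
by rewrite classical_sets.setUC; exact: turn_config_edge (turn_config_sym tc) Bi.
Qed.

End Edge.

Local Open Scope classical_set_scope.

Theorem theorem3p4 (R : realType) (p : nat) (D H : dag p) (G : ugraph p)
    (skelD : has_skeleton D G) (skelH : has_skeleton H G)
    (DH_turn : turn_pair R D H) :
  is_edge (CIM R G) (conv [set char_imset R D; char_imset R H]).
Proof.
case: DH_turn => [i [j [A [B [tp|tp]]]]]; first exact: turn_pair_wrt_edge tp.
by rewrite classical_sets.setUC; exact: turn_pair_wrt_edge tp.
Qed.
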